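(* Let $\{|x\rangle\}_{x\in\mathcal X}$ be an orthonormal basis of $X$ and, for each $x$, let $\{\omega^{x,\theta}_B\}_\theta$ be a differentiable family of density operators. Define the classical--quantum channels $\mathcal N^\theta_{X\to B}(\sigma_X):=\sum_x\langle x|\sigma_X|x\rangle\,\omega^{x,\theta}_B$. Then $$I_F(\theta;\{\mathcal N^\theta_{X\to B}\}_\theta)=I^{\mathcal A}_F(\theta;\{\mathcal N^\theta_{X\to B}\}_\theta)=\sup_xI_F(\theta;\{\omega^{x,\theta}_B\}_\theta).$$
   Context: Finite-dimensional systems. For a differentiable family $\{\rho_\theta\}_\theta$ of density operators with spectral decomposition $\rho_\theta=\sum_j\lambda^j_\theta|\psi^j_\theta\rangle\langle\psi^j_\theta|$ and kernel projection $\Pi^\perp_{\rho_\theta}$, the SLD Fisher information is $I_F(\theta;\{\rho_\theta\}_\theta)=2\sum_{j,k:\lambda^j_\theta+\lambda^k_\theta>0}\frac{|\langle\psi^j_\theta|(\partial_\theta\rho_\theta)|\psi^k_\theta\rangle|^2}{\lambda^j_\theta+\lambda^k_\theta}$ if $\Pi^\perp_{\rho_\theta}(\partial_\theta\rho_\theta)\Pi^\perp_{\rho_\theta}=0$, else $+\infty$. For a channel family, $I_F(\theta;\{\mathcal N^\theta_{A\to B}\}_\theta):=\sup_{\rho_{RA}}I_F(\theta;\{\mathcal N^\theta_{A\to B}(\rho_{RA})\}_\theta)$ over states $\rho_{RA}$ with arbitrary reference $R$, and the amortized version is $I^{\mathcal A}_F(\theta;\{\mathcal N^\theta_{A\to B}\}_\theta):=\sup_{\{\rho^\theta_{RA}\}_\theta}[I_F(\theta;\{\mathcal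 N^\theta_{A\to B}(\rho^\theta_{RA})\}_\theta)-I_F(\theta;\{\rho^\theta_{RA}\}_\theta)]$ over differentiable families of states with arbitrary $R$. *)

(* Defs.v *)
(* MathComp 2.5 + MathComp-Analysis 1.16 + real-closed (complex numbers R[i]). *)
From HB Require Import structures.
From mathcomp Require Import all_boot all_order all_algebra.
From mathcomp Require Import complex spectral sesquilinear.
From mathcomp Require Import all_classical all_reals all_analysis.

Set Implicit Arguments.
Unset Strict Implicit.
Unset Printing Implicit Defensive.

Import Order.TTheory GRing.Theory Num.Theory.
Local Open Scope ring_scope.
Local Open Scope sesquilinear_scope.

Section QFI.
Variable R : realType.
Local Notation C := (complex R).

(* Density operator: Hermitian, positive semidefinite, unit trace. *)
Definition hermitian n (A : 'M[C]_n) : Prop := A ^t* = A.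
Definition psd n (A : 'M[C]_n) : Prop :=
  forall v : 'rV[C]_n, 0 <= (v *m A *m v ^t*) 0 0.
Definition density n (A : 'M[C]_n) : Prop :=
  hermitian A /\ psd A /\ \tr A = 1.

(* Entrywise derivative (real and imaginary parts) of a matrix family. *)
Definition mx_derivable n (rho : R -> 'M[C]_n) (t : R) : Prop :=
  forall i j, derivable (fun s => complex.Re (rho s i j)) t 1 /\
              derivable (fun s => complex.Im (rho s i j)) t 1.
Definition dmx n (rho : R -> 'M[C]_n) (t : R) : 'M[C]_n :=
  \matrix_(i, j) complex.Complex
     (derive1 (fun s => complex.Re (rho s i j)) t)
     (derive1 (fun s => complex.Im (rho s i j)) t).

(* Differentiable family of density operators. *)
Definition diff_density_family n (rho : R -> 'M[C]_n) : Prop :=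
  (forall t, density (rho t)) /\ (forall t, mx_derivable rho t).

(* SLD Fisher information of a state rho with derivative D, computed from the
   spectral decomposition rho = sum_j l_j |psi_j><psi_j| given by MathComp's
   spectral theorem: rho = M^t* diag(l) M, so |psi_j> is the j-th column of
   M^t* and <psi_j| is the j-th row of M. *)
Definition SLD_FI n (rho D : 'M[C]_n) : \bar R :=
  let M := spectralmx rho in
  let l := spectral_diag rho in
  let Dt := M *m D *m M ^t* in
  let Pker := M ^t* *m diag_mx (\row_j (if l 0 j == 0 then 1 else 0)) *m M in
  if Pker *m D *m Pker == 0 then
    (complex.Re (2 * \sum_(j < n) \sum_(k < n | 0 < l 0 j + l 0 k)
                 (`|Dt j k| ^+ 2 / (l 0 j + l 0 k))))%:E
  else +oo%E.

(* I_F(theta; {rho_theta}) *)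
Definition FI_family n (rho : R -> 'M[C]_n) (t : R) : \bar R :=
  SLD_FI (rho t) (dmx rho t).

(* Systems R (dim r) and A (dim a): index (i,k) of R (x) A is mxvec_index i k. *)
Definition pair_of_index r a (p : 'I_(r * a)) : 'I_r * 'I_a :=
  enum_val (cast_ord (esym (mxvec_cast r a)) p).

(* (id_R (x) N)(rho_RA) for a linear map N : M_a -> M_b. *)
Definition id_tens r a b (N : 'M[C]_a -> 'M[C]_b) (rho : 'M[C]_(r * a))
  : 'M[C]_(r * b) :=
  \matrix_(p, q)
    (N (\matrix_(k, l) rho (mxvec_index (pair_of_index p).1 k)
                           (mxvec_index (pair_of_index q).1 l)))
      (pair_of_index p).2 (pair_of_index q).2.

(* Fisher information of a channel family. *)
Definition FI_channel a b (N : R -> 'M[C]_a -> 'M[C]_b) (t : R) : \bar R :=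
  ereal_sup [set v | exists (r : nat) (rho : 'M[C]_(r * a)),
     density rho /\ v = FI_family (fun s => id_tens (N s) rho) t].

(* Amortized Fisher information of a channel family.  The difference is only
   taken over input families with finite Fisher information (otherwise the
   difference +oo - (+oo) is undefined). *)
Definition FI_amortized a b (N : R -> 'M[C]_a -> 'M[C]_b) (t : R) : \bar R :=
  ereal_sup [set v | exists (r : nat) (rho : R -> 'M[C]_(r * a)),
     diff_density_family rho /\ (FI_family rho t < +oo)%E /\
     v = (FI_family (fun s => id_tens (N s) (rho s)) t - FI_family rho t)%E].

(* Classical-quantum channel sigma |-> sum_x <x|sigma|x> omega^{x,theta}. *)
Definition cq_channel dX dB (omega : 'I_dX -> R -> 'M[C]_dB) (t : R)
  (sigma : 'M[C]_dX) : 'M[C]_dB :=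
  \sum_(x < dX) sigma x x *: omega x t.

End QFI.

(* Main.v *)
(** The SLD Fisher information of [(rho, D)] is the supremum over Hermitian [X]
    of [2 tr (X D) - tr (rho X^2)], and it is finite exactly when [D] has a
    symmetric logarithmic derivative [K], [2 D = rho K + K rho], in which case
    it equals [tr (rho K^2)].

    On an input family [rho] the cq channel outputs [sum_x rho_x (x) omega_x],
    where [rho_x] is the block [<x|rho|x>].  Testing [rho] against block
    diagonal [X] shows that every [rho_x] has an SLD [K_x] and that
    [sum_x tr (rho_x K_x^2)] is at most the Fisher information of [rho].  If
    [L_x] is an SLD of [omega_x], then [K_x (x) 1 + 1 (x) L_x] is an SLD of
    [rho_x (x) omega_x] with information
    [tr (rho_x K_x^2) + tr rho_x tr (omega_x L_x^2)], as [tr (omega_x L_x) = 0].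
    Summing over [x] bounds the information of the output by that of [rho] plus
    [sup_x tr (omega_x L_x^2)].  The input [|x><x|] attains each [omega_x]. *)
Require Import Defs.
From HB Require Import structures.
From mathcomp Require Import all_boot all_order all_algebra.
From mathcomp Require Import complex spectral sesquilinear.
From mathcomp Require Import all_classical all_reals all_analysis.
From mathcomp Require Import ring lra.

Set Implicit Arguments.
Unset Strict Implicit.
Unset Printing Implicit Defensive.

Import Order.TTheory GRing.Theory Num.Theory.
Import numFieldNormedType.Exports.
(* [sesquilinear] shadows [hermitian]. *)
Import Defs.

Local Open Scope ring_scope.
Local Open Scope sesquilinear_scope.

(** * Adjoints, Hermitian matrices and positive semidefinite matrices *)

Section Adjoint.
Variable R : realType.
Local Notation C := (complex R).

Lemma trmxC_mul m n p (A : 'M[C]_(m, n)) (B : 'M[C]_(n, p)) :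
  (A *m B) ^t* = B ^t* *m A ^t*.
Proof. by rewrite trmx_mul map_mxM. Qed.

Lemma trmxCD m n (A B : 'M[C]_(m, n)) : (A + B) ^t* = A ^t* + B ^t*.
Proof. by rewrite linearD map_mxD. Qed.

Lemma trmxC1 n : (1%:M : 'M[C]_n) ^t* = 1%:M.
Proof. by rewrite trmx1 map_mx1. Qed.

Lemma hermitianE n (A : 'M[C]_n) : hermitian A ->
  forall i j, A j i = Num.conj (A i j).
Proof. by move=> hA i j; rewrite -{1}hA !mxE. Qed.

Lemma hermitian_congr m n (V : 'M[C]_(m, n)) (A : 'M[C]_n) :
  hermitian A -> hermitian (V *m A *m V ^t*).
Proof. by move=> hA; rewrite /hermitian !trmxC_mul trmxCK hA mulmxA. Qed.

Lemma psd_congr m n (V : 'M[C]_(m, n)) (A : 'M[C]_n) :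
  psd A -> psd (V *m A *m V ^t*).
Proof.
by move=> pA v; have := pA (v *m V); rewrite trmxC_mul !mulmxA.
Qed.

Lemma mulmx_trmxC_diag m n (A : 'M[C]_(m, n)) i :
  (A *m A ^t*) i i = \sum_j `|A i j| ^+ 2.
Proof. by rewrite mxE; apply: eq_bigr => j _; rewrite !mxE normCK. Qed.

Lemma psd1 n : psd (1%:M : 'M[C]_n).
Proof.
by move=> v; rewrite mulmx1 mulmx_trmxC_diag sumr_ge0.
Qed.

Lemma psd_tr_ge0 n (A : 'M[C]_n) : psd A -> 0 <= \tr A.
Proof.
move=> pA; apply: sumr_ge0 => i _.
have := pA (delta_mx 0 i); rewrite -rowE trmx_delta map_delta_mx.
by rewrite -colE !mxE.
Qed.

(** Cyclicity turns the trace into that of the congruence [X A X], which is positive semidefinite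
    because [X] is its own adjoint. *)
Lemma psd_tr_sqr_ge0 n (A X : 'M[C]_n) :
  psd A -> hermitian X -> 0 <= \tr (A *m X *m X).
Proof.
move=> pA hX; rewrite mxtrace_mulC mulmxA -{2}hX.
exact/psd_tr_ge0/psd_congr.
Qed.

Lemma tr_mul_trmxC_eq0 m n (A : 'M[C]_(m, n)) : \tr (A *m A ^t*) = 0 -> A = 0.
Proof.
move=> trA0; apply/matrixP => i j; rewrite mxE; apply/eqP.
have ge0 k : 0 <= (A *m A ^t*) k k.
  by rewrite mulmx_trmxC_diag sumr_ge0// => l _; rewrite exprn_ge0.
have /eqP := trA0; rewrite psumr_eq0// => /allP /(_ i); rewrite mem_index_enum.
move=> /(_ isT)/=; rewrite mulmx_trmxC_diag psumr_eq0; last first.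
  by move=> l _; rewrite exprn_ge0.
move=> /allP /(_ j); rewrite mem_index_enum => /(_ isT)/=.
by rewrite expf_eq0/= normr_eq0.
Qed.

End Adjoint.

(** * Spectral decomposition of a positive semidefinite matrix *)

Section Spectral.
Variables (R : realType) (n : nat) (rho : 'M[complex R]_n).
Local Notation C := (complex R).
Hypotheses (rhoh : hermitian rho) (rhop : psd rho).

Let M := spectralmx rho.
Let l := spectral_diag rho.

Lemma mul_spectralmx_trmxC : M *m M ^t* = 1%:M.
Proof. exact/unitarymxP/spectral_unitarymx. Qed.

Lemma mul_trmxC_spectralmx : M ^t* *m M = 1%:M.
Proof.
by rewrite -invmx_unitary ?spectral_unitarymx// mulVmx// spectral_unit.
Qed.

Lemma spectralmxK m (A : 'M[C]_(m, n)) : A *m M *m M ^t* = A.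
Proof. by rewrite -mulmxA mul_spectralmx_trmxC mulmx1. Qed.

Lemma spectralmx_congrM (A B : 'M[C]_n) :
  (M ^t* *m A *m M) *m (M ^t* *m B *m M) = M ^t* *m (A *m B) *m M.
Proof. by rewrite !mulmxA spectralmxK. Qed.

Lemma hermitian_spectralE : rho = M ^t* *m diag_mx l *m M.
Proof.
rewrite -invmx_unitary ?spectral_unitarymx//; apply/orthomx_spectralP/normalmxP.
by rewrite rhoh.
Qed.

Lemma spectralmx_congr : M *m rho *m M ^t* = diag_mx l.
Proof.
rewrite {1}hermitian_spectralE !mulmxA mul_spectralmx_trmxC mul1mx.
exact: spectralmxK.
Qed.

Lemma psd_spectral_diag_ge0 j : 0 <= l 0 j.
Proof.
have := psd_congr M rhop (delta_mx 0 j).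
rewrite spectralmx_congr -rowE trmx_delta map_delta_mx -colE !mxE.
by rewrite eqxx mulr1n.
Qed.

(** [H] has the eigenvectors as columns, scaled by the square roots of the eigenvalues. This
    factorization later gives the positivity of Kronecker products. *)
Lemma psd_gram : exists H : 'M[C]_n, rho = H *m H ^t*.
Proof.
exists (M ^t* *m diag_mx (map_mx sqrtC l)).
rewrite trmxC_mul trmxCK mulmxA -[X in X *m M]mulmxA.
rewrite {1}hermitian_spectralE; congr (_ *m _ *m _).
rewrite tr_diag_mx map_diag_mx mulmx_diag; congr diag_mx; apply/rowP => j.
rewrite !mxE/= geC0_conj ?sqrtC_ge0 ?psd_spectral_diag_ge0//.
by rewrite -expr2 sqrtCK.
Qed.

(** * The SLD Fisher information in the eigenbasis *)

Section Derivative.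
Variable D : 'M[C]_n.
Hypothesis Dh : hermitian D.

Let Dt := M *m D *m M ^t*.
Let E : 'M[C]_n := diag_mx (\row_j (if l 0 j == 0 then 1 else 0)).
Let Pker := M ^t* *m E *m M.

Let DE : D = M ^t* *m Dt *m M.
Proof.
rewrite /Dt !mulmxA mul_trmxC_spectralmx mul1mx -mulmxA mul_trmxC_spectralmx.
by rewrite mulmx1.
Qed.

Let Dth : hermitian Dt. Proof. exact: hermitian_congr. Qed.

Let PkerD : Pker *m D *m Pker = M ^t* *m (E *m Dt *m E) *m M.
Proof. by rewrite /Pker /Dt !mulmxA. Qed.

Let trmxCE : E ^t* = E.
Proof.
rewrite tr_diag_mx map_diag_mx; congr diag_mx; apply/rowP => j; rewrite !mxE.
by case: ifP => _; rewrite ?rmorph1 ?rmorph0.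
Qed.

Let trmxCPker : Pker ^t* = Pker.
Proof. by rewrite !trmxC_mul trmxCK trmxCE mulmxA. Qed.

Let PkerK : Pker *m Pker = Pker.
Proof.
rewrite /Pker !mulmxA spectralmxK -(mulmxA (M ^t*)) mulmx_diag.
congr (_ *m diag_mx _ *m _).
by apply/rowP => j; rewrite !mxE; case: ifP => _; rewrite ?mulr1 ?mulr0.
Qed.

Let rhoPker : rho *m Pker = 0.
Proof.
rewrite {1}hermitian_spectralE /Pker !mulmxA spectralmxK.
rewrite -(mulmxA (M ^t*)) mulmx_diag [X in diag_mx X](_ : _ = 0) ?linear0 ?mulmx0 ?mul0mx//.
by apply/rowP => j; rewrite !mxE; case: ifP => [/eqP->|_];
  rewrite ?mul0r ?mulr0.
Qed.

(** [Z] is the kernel block [Pker D Pker], nonzero when the information is infinite. As [Pker] is an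
    orthogonal projection, tr (Z D) is the squared Hilbert-Schmidt norm of [Z]. Along real multiples
    X of [Z] the quantity 2 tr (X D) - tr (rho X^2) is therefore unbounded. *)
Lemma SLD_FI_pinfty : SLD_FI rho D = +oo%E ->
  exists Z : 'M[C]_n, [/\ hermitian Z, rho *m Z = 0 & 0 < \tr (Z *m D)].
Proof.
rewrite /SLD_FI -/M -/l -/E -/Pker; case: ifPn => // nz _.
exists (Pker *m D *m Pker).
have Zh : hermitian (Pker *m D *m Pker).
  by rewrite -{2}trmxCPker; exact: hermitian_congr.
split=> //.
  by move: rhoPker; clear; move: Pker => P rP; rewrite !mulmxA rP !mul0mx.
have -> : \tr (Pker *m D *m Pker *m D) =
  \tr ((Pker *m D *m Pker) *m (Pker *m D *m Pker) ^t*).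
  rewrite Zh; move: PkerK; clear; move: Pker => P PK.
  rewrite [in RHS]mulmxA [in RHS]mxtrace_mulC !mulmxA PK.
  by rewrite -[P *m D *m P *m P]mulmxA PK.
rewrite lt_neqAle eq_sym psd_tr_ge0 ?andbT.
  by apply: contra nz => /eqP /tr_mul_trmxC_eq0 ->.
by rewrite -[X in psd (X *m _)]mulmx1; apply/psd_congr/psd1.
Qed.

(** In the eigenbasis the SLD equation reads (l_j + l_k) K_jk = 2 D_jk. Finiteness says that D_jk
    vanishes where both eigenvalues do, so division solves the equation. *)
Lemma SLD_FI_finite : (SLD_FI rho D < +oo)%E ->
  exists K : 'M[C]_n, [/\ hermitian K, 2%:R *: D = rho *m K + K *m rho &
    SLD_FI rho D = (complex.Re (\tr (rho *m K *m K)))%:E].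
Proof.
rewrite /SLD_FI -/M -/l -/E -/Pker -/Dt; case: ifPn => // /eqP Dker _.
have lge0 := psd_spectral_diag_ge0.
have EDE : E *m Dt *m E = 0.
  have : M *m (M ^t* *m (E *m Dt *m E) *m M) *m M ^t* = 0.
    by rewrite -PkerD Dker mulmx0 mul0mx.
  rewrite !mulmxA mul_spectralmx_trmxC mul1mx.
  by rewrite spectralmxK.
have Dt0 j k : l 0 j = 0 -> l 0 k = 0 -> Dt j k = 0.
  move=> lj lk; move/matrixP: EDE => /(_ j k).
  by rewrite mul_mx_diag mul_diag_mx !mxE lj lk !eqxx mul1r mulr1.
(* The default 0 occurs only where l_j = l_k = 0; there [Dt j k] is 0 as well and the equation still
   holds. *)
pose Kt : 'M[C]_n := \matrix_(j, k)
  (if 0 < l 0 j + l 0 k then 2%:R * Dt j k / (l 0 j + l 0 k) else 0).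
have KtE j k : Kt j k =
  if 0 < l 0 j + l 0 k then 2%:R * Dt j k / (l 0 j + l 0 k) else 0.
  by rewrite mxE.
have Kth : hermitian Kt.
  apply/matrixP => j k.
  have -> : (Kt ^t*) j k = Num.conj (Kt k j) by rewrite !mxE.
  rewrite !KtE addrC.
  case: ifP => _; last by rewrite rmorph0.
  rewrite rmorphM/= fmorphV/= (geC0_conj (addr_ge0 (lge0 j) (lge0 k))).
  by rewrite rmorphM/= conjC_nat (hermitianE Dth j k) conjCK.
have lKt j k : (l 0 j + l 0 k) * Kt j k = 2%:R * Dt j k.
  rewrite KtE; case: ifPn => [lt0|]; first by rewrite mulrC divfK// gt_eqF.
  rewrite lt_neqAle addr_ge0// andbT negbK eq_sym paddr_eq0//.
  move=> /andP[/eqP lj /eqP lk].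
  by rewrite Dt0// !mulr0.
have rKK : 2%:R *: D = rho *m (M ^t* *m Kt *m M) + (M ^t* *m Kt *m M) *m rho.
  rewrite {1 2}hermitian_spectralE DE !spectralmx_congrM -mulmxDl -mulmxDr.
  rewrite scalemxAl scalemxAr; congr (_ *m _ *m _); apply/matrixP => j k.
  by rewrite [LHS]mxE -lKt mul_mx_diag mul_diag_mx !mxE; ring.
exists (M ^t* *m Kt *m M); split => //.
  by rewrite -{2}(trmxCK M); exact: hermitian_congr.
set K := M ^t* *m Kt *m M in rKK *.
(* By the SLD equation 2 tr (D K) has two terms, both equal to tr (rho K^2) by cyclicity. *)
have -> : \tr (rho *m K *m K) = \tr (D *m K).
  have : 2%:R * \tr (D *m K) = 2%:R * \tr (rho *m K *m K).
    rewrite -mxtraceZ scalemxAl rKK mulmxDl mxtraceD mulr_natl mulr2n.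
    by rewrite -[K *m rho *m K]mulmxA [\tr (K *m _)]mxtrace_mulC.
  by move/(mulfI _) => ->//; rewrite pnatr_eq0.
congr (complex.Re _)%:E.
(* Entrywise Dt_jk Kt_kj = 2 |Dt_jk|^2 / (l_j + l_k), the summand in the definition of the
   information. *)
have -> : \tr (D *m K) = \tr (Dt *m Kt).
  rewrite {1}DE /K spectralmx_congrM mxtrace_mulC mulmxA.
  by rewrite mul_spectralmx_trmxC mul1mx.
rewrite mulr_sumr; apply: eq_bigr => j _; rewrite mxE mulr_sumr.
rewrite big_mkcond; apply: eq_bigr => k _; rewrite KtE [l 0 k + _]addrC.
case: ifP => _; last by rewrite mulr0.
by rewrite normCK (hermitianE Dth j k) -!mulrA; ring.
Qed.

End Derivative.
End Spectral.

(** * The variational formula for the SLD Fisher information *)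

Section Variational.
Variables (R : realType) (n : nat) (rho D : 'M[complex R]_n).
Local Notation C := (complex R).
Local Notation "x %:C" := (real_complex R x).
Hypothesis rhop : psd rho.

(** The trace is nonnegative, hence real, so information values can be compared in the order of
    [C]. *)
Lemma psd_tr_sqr_Re (K : 'M[C]_n) : hermitian K ->
  (complex.Re (\tr (rho *m K *m K)))%:C = \tr (rho *m K *m K).
Proof. by move=> hK; rewrite RRe_real// ger0_real// psd_tr_sqr_ge0. Qed.

Lemma tr_mul_SLD (K X : 'M[C]_n) : 2%:R *: D = rho *m K + K *m rho ->
  2%:R * \tr (X *m D) = \tr (rho *m K *m X) + \tr (rho *m X *m K).
Proof.
move=> DK; rewrite -mxtraceZ scalemxAr DK mulmxDr mxtraceD; congr (_ + _).
  by rewrite mxtrace_mulC.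
by rewrite mulmxA mxtrace_mulC mulmxA.
Qed.

(* The defect is [tr (rho (X - K)^2) >= 0]. *)
Lemma SLD_variational (K X : 'M[C]_n) :
  hermitian K -> hermitian X -> 2%:R *: D = rho *m K + K *m rho ->
  2%:R * \tr (X *m D) - \tr (rho *m X *m X) <= \tr (rho *m K *m K).
Proof.
move=> hK hX /(tr_mul_SLD X) ->; rewrite -subr_ge0.
have hXK : hermitian (X - K).
  by rewrite /hermitian -scaleN1r trmxCD linearZ/= map_mxZ hX hK rmorphN1.
have := psd_tr_sqr_ge0 rhop hXK; congr (_ <= _).
by rewrite !(mulmxBr, mulmxBl) !linearB/=; ring.
Qed.

(** An infinite value would violate the bound along multiples of the kernel witness [Z]; a finite
    value is attained at [X = K]. Finiteness is thus part of the conclusion. *)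
Lemma SLD_FI_le (c : R) : hermitian rho -> hermitian D ->
  (forall X, hermitian X ->
     2%:R * \tr (X *m D) - \tr (rho *m X *m X) <= c%:C) ->
  (SLD_FI rho D <= c%:E)%E.
Proof.
move=> rhoh Dh H; have [|/eqP FIlt] := eqVneq (SLD_FI rho D) +oo%E.
  move=> /(SLD_FI_pinfty rhoh Dh)[Z [hZ rZ trZ]]; exfalso.
  have aE : (complex.Re (\tr (Z *m D)))%:C = \tr (Z *m D).
    by rewrite RRe_real// ger0_real// ltW.
  move: trZ; rewrite -aE ltcR; set a := complex.Re _ => a_gt0.
  (* For X = t Z the quadratic term vanishes and 2 tr (X D) = 2 (|c| + 1) exceeds c. *)
  pose t := (`|c| + 1) / a.
  have hX : hermitian (t%:C *: Z).
    rewrite /hermitian linearZ/= map_mxZ/= hZ conj_Creal//.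
    by apply/complex_realP; exists t.
  have := H _ hX; rewrite -!scalemxAr rZ !(scaler0, mul0mx) mxtrace0 subr0.
  rewrite -scalemxAl mxtraceZ -aE -/a -rmorphM/= /t divfK ?gt_eqF//.
  rewrite -(rmorph_nat (real_complex R)) -rmorphM/= lecR.
  by have := ler_norm c; have := normr_ge0 c; lra.
have /(SLD_FI_finite rhoh rhop Dh)[K [hK DK ->]] : (SLD_FI rho D < +oo)%E.
  by rewrite ltey; apply/eqP.
rewrite lee_fin -lecR psd_tr_sqr_Re//; apply: le_trans (H _ hK).
by rewrite (tr_mul_SLD K DK) addrK.
Qed.

End Variational.

(** * Kronecker products *)

Section Kronecker.
Variable R : realType.
Local Notation C := (complex R).

Lemma mxvec_indexK r b i k : pair_of_index (@mxvec_index r b i k) = (i, k).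
Proof. by rewrite /pair_of_index cast_ordK enum_rankK. Qed.

Lemma eq_mxvec_index r b i k j l :
  (@mxvec_index r b i k == mxvec_index j l) = (i == j) && (k == l).
Proof.
apply/eqP/andP => [/(congr1 (@pair_of_index _ _))|[/eqP-> /eqP->]//].
by rewrite !mxvec_indexK => -[-> ->].
Qed.

Lemma sum_mxvec_index r b (F : 'I_(r * b) -> C) :
  \sum_p F p = \sum_i \sum_k F (mxvec_index i k).
Proof.
by rewrite pair_bigA (reindex _ (curry_mxvec_bij _ _))/=; apply: eq_bigr => -[].
Qed.

(** Indices are decoded as in [id_tens], with the reference system as first factor. *)
Definition kron r b (A : 'M[C]_r) (B : 'M[C]_b) : 'M[C]_(r * b) :=
  \matrix_(p, q) (A (pair_of_index p).1 (pair_of_index q).1 *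
                  B (pair_of_index p).2 (pair_of_index q).2).

Lemma kron_mul r b (A A' : 'M[C]_r) (B B' : 'M[C]_b) :
  kron A B *m kron A' B' = kron (A *m A') (B *m B').
Proof.
apply/matrixP => p q; rewrite !mxE sum_mxvec_index mulr_suml.
apply: eq_bigr => i _; rewrite mulr_sumr; apply: eq_bigr => k _.
by rewrite !mxE !mxvec_indexK/=; ring.
Qed.

Lemma tr_kron r b (A : 'M[C]_r) (B : 'M[C]_b) :
  \tr (kron A B) = \tr A * \tr B.
Proof.
rewrite /mxtrace sum_mxvec_index mulr_suml; apply: eq_bigr => i _.
by rewrite mulr_sumr; apply: eq_bigr => k _; rewrite !mxE !mxvec_indexK.
Qed.

Lemma trmxC_kron r b (A : 'M[C]_r) (B : 'M[C]_b) :
  (kron A B) ^t* = kron (A ^t*) (B ^t*).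
Proof. by apply/matrixP => p q; rewrite !mxE rmorphM. Qed.

Lemma kronDl r b (A A' : 'M[C]_r) (B : 'M[C]_b) :
  kron (A + A') B = kron A B + kron A' B.
Proof. by apply/matrixP => p q; rewrite !mxE mulrDl. Qed.

Lemma kronDr r b (A : 'M[C]_r) (B B' : 'M[C]_b) :
  kron A (B + B') = kron A B + kron A B'.
Proof. by apply/matrixP => p q; rewrite !mxE mulrDr. Qed.

Lemma kronZl r b c (A : 'M[C]_r) (B : 'M[C]_b) :
  kron (c *: A) B = c *: kron A B.
Proof. by apply/matrixP => p q; rewrite !mxE mulrA. Qed.

Lemma kronZr r b c (A : 'M[C]_r) (B : 'M[C]_b) :
  kron A (c *: B) = c *: kron A B.
Proof. by apply/matrixP => p q; rewrite !mxE mulrCA. Qed.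

Lemma hermitian_kron r b (A : 'M[C]_r) (B : 'M[C]_b) :
  hermitian A -> hermitian B -> hermitian (kron A B).
Proof. by move=> hA hB; rewrite /hermitian trmxC_kron hA hB. Qed.

(** The product of the Gram factors is a Gram factor of the product. *)
Lemma psd_kron r b (A : 'M[C]_r) (B : 'M[C]_b) :
  hermitian A -> psd A -> hermitian B -> psd B -> psd (kron A B).
Proof.
move=> hA /(psd_gram hA)[G ->] hB /(psd_gram hB)[H ->].
rewrite -kron_mul -trmxC_kron -[X in psd (X *m _)]mulmx1.
exact/psd_congr/psd1.
Qed.

Lemma hermitian1 n : hermitian (1%:M : 'M[C]_n). Proof. exact: trmxC1. Qed.

Lemma hermitianD n (A B : 'M[C]_n) :
  hermitian A -> hermitian B -> hermitian (A + B).
Proof. by move=> hA hB; rewrite /hermitian trmxCD hA hB. Qed.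

Lemma hermitian_sum n I (s : seq I) (F : I -> 'M[C]_n) :
  (forall i, hermitian (F i)) -> hermitian (\sum_(i <- s) F i).
Proof.
move=> hF; apply: big_ind => //; last exact: hermitianD.
by rewrite /hermitian trmx0 map_mx0.
Qed.

Lemma tr_sum n I (s : seq I) (F : I -> 'M[C]_n) :
  \tr (\sum_(i <- s) F i) = \sum_(i <- s) \tr (F i).
Proof. exact: raddf_sum. Qed.

Lemma psd_sum n I (s : seq I) (F : I -> 'M[C]_n) :
  (forall i, psd (F i)) -> psd (\sum_(i <- s) F i).
Proof.
move=> pF v; rewrite mulmx_sumr mulmx_suml summxE.
by apply: sumr_ge0 => i _; exact: pF.
Qed.

(** * Blocks along the classical basis *)

Section Blocks.
Variables r a : nat.

(** The partial matrix element <x|A|x>, an operator on the reference. *)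
Definition blk (x : 'I_a) (A : 'M[C]_(r * a)) : 'M[C]_r :=
  \matrix_(i, j) A (mxvec_index i x) (mxvec_index j x).

(** The isometry |i> -> |i>|x>; it exhibits [blk x] as a congruence, which preserves Hermiticity and
    positivity. *)
Definition blk_emb (x : 'I_a) : 'M[C]_(r * a, r) :=
  \matrix_(p, i) (p == mxvec_index i x)%:R.

Local Notation V := blk_emb.

Lemma blkE x A : blk x A = (V x) ^t* *m A *m V x.
Proof.
apply/matrixP => i j; rewrite !mxE (bigD1 (mxvec_index j x))//= big1 ?addr0.
  rewrite !mxE eqxx mulr1 (bigD1 (mxvec_index i x))//= big1 ?addr0.
    by rewrite !mxE eqxx rmorph1 mul1r.
  by move=> p /negPf pE; rewrite !mxE pE rmorph0 mul0r.
by move=> p /negPf pE; rewrite !mxE pE mulr0.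
Qed.

Lemma mul_blk_emb x y : (V x) ^t* *m V y = (x == y)%:R%:M.
Proof.
apply/matrixP => i j; rewrite !mxE (bigD1 (mxvec_index i x))//= big1 ?addr0.
  rewrite !mxE eqxx rmorph1 mul1r eq_mxvec_index.
  by case: (i == j); case: (x == y).
by move=> p /negPf pE; rewrite !mxE pE rmorph0 mul0r.
Qed.

Lemma tr_blk (A : 'M[C]_(r * a)) : \tr A = \sum_x \tr (blk x A).
Proof.
rewrite /mxtrace sum_mxvec_index exchange_big/=; apply: eq_bigr => x _.
by apply: eq_bigr => i _; rewrite mxE.
Qed.

Lemma hermitian_blk x A : hermitian A -> hermitian (blk x A).
Proof.
move=> hA; rewrite blkE -[X in hermitian (_ *m X)]trmxCK.
exact: hermitian_congr.
Qed.

Lemma psd_blk x A : psd A -> psd (blk x A).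
Proof.
by move=> pA; rewrite blkE -[X in psd (_ *m X)]trmxCK; exact: psd_congr.
Qed.

(** The operator sum_x Z_x (x) |x><x|. *)
Definition blk_diag (Z : 'I_a -> 'M[C]_r) : 'M[C]_(r * a) :=
  \sum_x V x *m Z x *m (V x) ^t*.

Lemma hermitian_blk_diag Z :
  (forall x, hermitian (Z x)) -> hermitian (blk_diag Z).
Proof. by move=> hZ; apply: hermitian_sum => x; exact: hermitian_congr. Qed.

Lemma tr_blk_diag Z A : \tr (blk_diag Z *m A) = \sum_x \tr (Z x *m blk x A).
Proof.
rewrite mulmx_suml tr_sum; apply: eq_bigr => x _.
by rewrite blkE -!mulmxA mxtrace_mulC !mulmxA.
Qed.

(** The isometries [V x] have orthogonal ranges, so cross terms vanish and squaring acts block by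
    block. *)
Lemma tr_blk_diag2 Z A :
  \tr (A *m blk_diag Z *m blk_diag Z) = \sum_x \tr (blk x A *m Z x *m Z x).
Proof.
have -> : \tr (A *m blk_diag Z *m blk_diag Z) =
          \tr (blk_diag (fun x => Z x *m Z x) *m A).
  rewrite -mulmxA mxtrace_mulC; congr (\tr (_ *m _)).
  rewrite /blk_diag mulmx_suml; apply: eq_bigr => x _.
  rewrite mulmx_sumr (bigD1 x)//= big1 ?addr0; last first.
    move=> y /negPf yx; rewrite !mulmxA -[_ *m V y]mulmxA mul_blk_emb eq_sym yx.
    by rewrite -scalemx1 scale0r mulmx0 !mul0mx.
  by rewrite !mulmxA -[_ *m V x]mulmxA mul_blk_emb eqxx mulmx1.
by rewrite tr_blk_diag; apply: eq_bigr => x _; rewrite mxtrace_mulC mulmxA.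
Qed.

End Blocks.
End Kronecker.

(** * The information bound for a classical-quantum channel *)

Section CQBound.
Variable R : realType.
Local Notation C := (complex R).
Local Notation "x %:C" := (real_complex R x).

(** In the Leibniz derivative of a product, K (x) 1 accounts for the first term and 1 (x) L for the
    second. *)
Lemma SLD_kron r b (A D K : 'M[C]_r) (B W L : 'M[C]_b) :
  2%:R *: D = A *m K + K *m A -> 2%:R *: W = B *m L + L *m B ->
  2%:R *: (kron D B + kron A W) =
    kron A B *m (kron K 1%:M + kron 1%:M L) +
    (kron K 1%:M + kron 1%:M L) *m kron A B.
Proof.
move=> DK WL; rewrite scalerDr -kronZl -kronZr DK WL kronDl kronDr.
rewrite mulmxDr mulmxDl !kron_mul !mulmx1 !mul1mx.
by rewrite -!addrA; congr (_ + _); rewrite addrCA.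
Qed.

Lemma tr_SLD n (A D K : 'M[C]_n) :
  2%:R *: D = A *m K + K *m A -> \tr D = \tr (A *m K).
Proof.
move=> DK; apply: (mulfI (_ : 2%:R != 0)); first by rewrite pnatr_eq0.
by rewrite -mxtraceZ DK mxtraceD [\tr (K *m A)]mxtrace_mulC mulr_natl mulr2n.
Qed.

(** The cross terms are multiples of tr (B L) = tr W = 0. The factor tr A stays because blocks of a
    state are not normalized. *)
Lemma tr_SLD_kron r b (A K : 'M[C]_r) (B W L : 'M[C]_b) :
  2%:R *: W = B *m L + L *m B -> \tr W = 0 -> \tr B = 1 ->
  let S := kron K 1%:M + kron 1%:M L in
  \tr (kron A B *m S *m S) = \tr (A *m K *m K) + \tr A * \tr (B *m L *m L).
Proof.
move=> /tr_SLD trBL trW trB S.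
have BL0 : \tr (B *m L) = 0 by rewrite -trBL.
rewrite /S !(mulmxDr, mulmxDl) !kron_mul !mulmx1 !mxtraceD !tr_kron.
by rewrite trB BL0 !(mulr0, mulr1, addr0, add0r).
Qed.

(** The trace condition forces m = 1, a trivial reference. The two sides have different index types,
    so they are compared through the test operators 1 (x) X. *)
Lemma SLD_FI_kron1_ge b m (B W : 'M[C]_b) : density B -> hermitian W ->
  \tr (1%:M : 'M[C]_m) = 1 ->
  (SLD_FI B W <=
   SLD_FI (kron (1%:M : 'M[C]_m) B) (kron 1%:M W))%E.
Proof.
move=> [oh [op _]] Wh tr1.
have sh := hermitian_kron (@hermitian1 _ m) oh.
have sp := psd_kron (@hermitian1 _ m) (@psd1 _ m) oh op.
have Wsh := hermitian_kron (@hermitian1 _ m) Wh.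
have [->|/eqP FIlt] :=
  eqVneq (SLD_FI (kron (1%:M : 'M[C]_m) B) (kron 1%:M W)) +oo%E.
  exact: leey.
have /(SLD_FI_finite sh sp Wsh)[K [hK DK ->]] :
    (SLD_FI (kron (1%:M : 'M[C]_m) B) (kron 1%:M W) < +oo)%E.
  by rewrite ltey; apply/eqP.
apply: SLD_FI_le => // X hX; rewrite psd_tr_sqr_Re//.
have := SLD_variational sp hK (hermitian_kron (@hermitian1 _ m) hX) DK.
by rewrite !kron_mul !tr_kron !mulmx1 tr1 !mul1r.
Qed.

Variables (r a b : nat) (rho D : 'M[C]_(r * a)) (omega W : 'I_a -> 'M[C]_b).
Hypotheses (rhod : density rho) (Dh : hermitian D).
Hypotheses (omegad : forall x, density (omega x)).
Hypotheses (Wh : forall x, hermitian (W x)) (Wtr : forall x, \tr (W x) = 0).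

Lemma SLD_FI_cq_le (c : R) :
  (SLD_FI rho D < +oo)%E ->
  (forall x, (SLD_FI (omega x) (W x) <= c%:E)%E) ->
  (SLD_FI (\sum_x kron (blk x rho) (omega x))
     (\sum_x (kron (blk x D) (omega x) + kron (blk x rho) (W x)))
   <= SLD_FI rho D + c%:E)%E.
Proof.
have [rhoh [rhop trrho]] := rhod.
move=> /(SLD_FI_finite rhoh rhop Dh)[L [hL DL ->]] omegac.
(* The variational bound for [rho], restricted to block diagonal test operators. *)
have blkvar (X : 'I_a -> 'M[C]_r) : (forall x, hermitian (X x)) ->
    \sum_x (2%:R * \tr (X x *m blk x D) - \tr (blk x rho *m X x *m X x)) <=
    \tr (rho *m L *m L).
  move=> hX; have := SLD_variational rhop hL (hermitian_blk_diag hX) DL.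
  by rewrite tr_blk_diag tr_blk_diag2 mulr_sumr sumrB.
have /boolp.choice[K HK] : forall x, exists K : 'M[C]_r, hermitian K /\
    2%:R *: blk x D = blk x rho *m K + K *m blk x rho.
  move=> x; have rxh := hermitian_blk x rhoh; have rxp := psd_blk x rhop.
  have Dxh := hermitian_blk x Dh.
  have /(SLD_FI_finite rxh rxp Dxh)[K [hK DK _]] :
      (SLD_FI (blk x rho) (blk x D) < +oo)%E.
    apply: le_lt_trans (ltry (complex.Re (\tr (rho *m L *m L)))).
    apply: SLD_FI_le => // X hX; rewrite psd_tr_sqr_Re//.
    (* A test operator supported on block x alone bounds the information of that block, which is
       therefore finite and yields an SLD. *)
    pose Y y : 'M[C]_r := if y == x then X else 0.
    have := blkvar Y; rewrite (bigD1 x)//= big1 ?addr0 /Y ?eqxx => [|y /negPf->].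
      apply => y; case: ifP => // _.
      by rewrite /hermitian trmx0 map_mx0.
    by rewrite mulmx0 mul0mx !mxtrace0 mulr0 subr0.
  by exists K.
have /boolp.choice[M HM] : forall x, exists M : 'M[C]_b, [/\ hermitian M,
    2%:R *: W x = omega x *m M + M *m omega x &
    \tr (omega x *m M *m M) <= c%:C].
  move=> x; have [oh [op _]] := omegad x; have := omegac x.
  have /(SLD_FI_finite oh op (Wh x))[M [hM WM ->]] :
      (SLD_FI (omega x) (W x) < +oo)%E by apply: le_lt_trans (ltry c).
  by rewrite lee_fin -lecR psd_tr_sqr_Re// => Mc; exists M.
(* Each block bound is attained at its own SLD, and all blocks are tested at once. *)
have sum_K : \sum_x \tr (blk x rho *m K x *m K x) <= \tr (rho *m L *m L).
  apply: le_trans (blkvar K (fun x => (HK x).1)).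
  rewrite le_eqVlt; apply/orP; left; apply/eqP.
  by apply: eq_bigr => x _; rewrite (tr_mul_SLD _ (HK x).2) addrK.
have tau x : hermitian (kron (blk x rho) (omega x)) /\
             psd (kron (blk x rho) (omega x)).
  have [oh [op _]] := omegad x; split.
    exact/hermitian_kron/oh/hermitian_blk.
  by apply: psd_kron => //; [exact: hermitian_blk|exact: psd_blk].
rewrite -EFinD; apply: SLD_FI_le.
- by apply: psd_sum => x; exact: (tau x).2.
- by apply: hermitian_sum => x; exact: (tau x).1.
- apply: hermitian_sum => x; have [oh _] := omegad x.
  by apply: hermitianD; apply: hermitian_kron => //; exact: hermitian_blk.
move=> X hX; rewrite rmorphD/= psd_tr_sqr_Re//.
(* The test functional is additive over x, so one common [X] can be bounded in each term by the SLD
   of that term. *)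
rewrite mulmx_sumr !mulmx_suml !tr_sum mulr_sumr -sumrB.
(* The weights tr rho_x sum to tr rho = 1, so the second parts add up to c. *)
apply: (@le_trans _ _ (\sum_x (\tr (blk x rho *m K x *m K x) +
                               \tr (blk x rho) * c%:C))); last first.
  by rewrite big_split/= -mulr_suml -tr_blk trrho mul1r lerD2r.
apply: ler_sum => x _; have [hM WM Mc] := HM x; have [hK DK] := HK x.
have [_ [_ tro]] := omegad x.
apply: le_trans (SLD_variational (tau x).2 _ hX (SLD_kron DK WM)) _.
  by apply: hermitianD; apply: hermitian_kron => //; exact: hermitian1.
rewrite (tr_SLD_kron _ _ WM)// lerD2l ler_wpM2l// psd_tr_ge0//.
exact: psd_blk.
Qed.

End CQBound.

(** * Derivatives of complex-valued functions and matrix families *)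

Section ComplexDerivative.
Variable R : realType.
Local Notation C := (complex R).
Implicit Types (f g : R -> C) (t : R) (d e : C).

Lemma ReD (x y : C) : complex.Re (x + y) = complex.Re x + complex.Re y.
Proof. by case: x; case: y. Qed.

Lemma ImD (x y : C) : complex.Im (x + y) = complex.Im x + complex.Im y.
Proof. by case: x; case: y. Qed.

Lemma ReM (x y : C) : complex.Re (x * y) =
  complex.Re x * complex.Re y - complex.Im x * complex.Im y.
Proof. by case: x; case: y. Qed.

Lemma ImM (x y : C) : complex.Im (x * y) =
  complex.Re x * complex.Im y + complex.Im x * complex.Re y.
Proof. by case: x; case: y. Qed.

Lemma Re_conj (x : C) : complex.Re (Num.conj x) = complex.Re x.
Proof. by case: x. Qed.

Lemma Im_conj (x : C) : complex.Im (Num.conj x) = - complex.Im x.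
Proof. by case: x. Qed.

(** A relation, so that each calculus rule carries differentiability and the value of the derivative
    together. *)
Definition cis_derive f t d :=
  is_derive t (1 : R) (fun s => complex.Re (f s)) (complex.Re d) /\
  is_derive t (1 : R) (fun s => complex.Im (f s)) (complex.Im d).

Lemma cis_derive_unique f t d e : cis_derive f t d -> cis_derive f t e -> d = e.
Proof.
case: d e => [a b] [a' b'] /= [/= fa fb] [/= fa' fb'].
by rewrite -(@derive_val _ _ _ _ _ _ _ fa) -(@derive_val _ _ _ _ _ _ _ fb)
           (@derive_val _ _ _ _ _ _ _ fa') (@derive_val _ _ _ _ _ _ _ fb').
Qed.

Lemma cis_derive_cst (c : C) t : cis_derive (fun=> c) t 0.
Proof. by split; exact: is_derive_cst. Qed.

Lemma cis_deriveD f g t d e : cis_derive f t d -> cis_derive g t e ->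
  cis_derive (fun s => f s + g s) t (d + e).
Proof.
move=> [f1 f2] [g1 g2]; split.
  by under eq_fun do rewrite ReD; rewrite ReD; exact: is_deriveD.
by under eq_fun do rewrite ImD; rewrite ImD; exact: is_deriveD.
Qed.

Lemma cis_derive_sum I (r : seq I) (f : I -> R -> C) t (d : I -> C) :
  (forall i, cis_derive (f i) t (d i)) ->
  cis_derive (fun s => \sum_(i <- r) f i s) t (\sum_(i <- r) d i).
Proof.
move=> fd; elim: r => [|i r IH].
  under eq_fun do rewrite big_nil; rewrite big_nil; exact: cis_derive_cst.
under eq_fun do rewrite big_cons; rewrite big_cons; exact: cis_deriveD.
Qed.

Lemma cis_deriveM f g t d e : cis_derive f t d -> cis_derive g t e ->
  cis_derive (fun s => f s * g s) t (d * g t + f t * e).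
Proof.
move=> [f1 f2] [g1 g2]; split.
  under eq_fun do rewrite ReM.
  apply: is_derive_eq (is_deriveB (is_deriveM f1 g1) (is_deriveM f2 g2)) _.
  by rewrite ReD !ReM /GRing.scale/=; ring.
under eq_fun do rewrite ImM.
apply: is_derive_eq (is_deriveD (is_deriveM f1 g2) (is_deriveM f2 g1)) _.
by rewrite ImD !ImM /GRing.scale/=; ring.
Qed.

Lemma cis_derive_conj f t d : cis_derive f t d ->
  cis_derive (fun s => Num.conj (f s)) t (Num.conj d).
Proof.
move=> [f1 f2]; split.
  by under eq_fun do rewrite Re_conj; rewrite Re_conj.
by under eq_fun do rewrite Im_conj; rewrite Im_conj; exact: is_deriveN.
Qed.

Lemma mx_derivable_cis n (rho : R -> 'M[C]_n) t : mx_derivable rho t ->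
  forall i j, cis_derive (fun s => rho s i j) t (dmx rho t i j).
Proof.
move=> drho i j; have [d1 d2] := drho i j.
by split; rewrite mxE /= derive1E; apply: DeriveDef.
Qed.

Lemma dmxE n (rho : R -> 'M[C]_n) t i j d :
  cis_derive (fun s => rho s i j) t d -> dmx rho t i j = d.
Proof.
move=> [f1 f2]; rewrite mxE !derive1E.
rewrite (@derive_val _ _ _ _ _ _ _ f1) (@derive_val _ _ _ _ _ _ _ f2).
by case: (d).
Qed.

Lemma dmx_cst n (A : 'M[C]_n) t : dmx (fun=> A) t = 0.
Proof. by apply/matrixP => i j; rewrite [RHS]mxE; apply/dmxE/cis_derive_cst. Qed.

Lemma mx_derivable_cst n (A : 'M[C]_n) t : mx_derivable (fun=> A) t.
Proof. by move=> i j; split; exact: derivable_cst. Qed.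

Section DensityFamily.
Variables (n : nat) (rho : R -> 'M[C]_n).
Hypothesis rhof : diff_density_family rho.

(** Entry (i, j) is the conjugate of entry (j, i) at every parameter, and derivatives are unique. *)
Lemma hermitian_dmx t : hermitian (dmx rho t).
Proof.
have [rhod rhodiff] := rhof; apply/matrixP => i j; rewrite !mxE.
have := cis_derive_conj (mx_derivable_cis (rhodiff t) j i).
rewrite [in X in cis_derive _ _ X]mxE => /cis_derive_unique; apply.
have := mx_derivable_cis (rhodiff t) i j; rewrite mxE.
congr (cis_derive _ _ _); apply/funext => s.
by have [rhoh _] := rhod s; rewrite -hermitianE.
Qed.

Lemma tr_dmx t : \tr (dmx rho t) = 0.
Proof.
have [rhod rhodiff] := rhof.
have := cis_derive_sum (index_enum _)
  (fun i => mx_derivable_cis (rhodiff t) i i).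
move=> /cis_derive_unique; apply; have := cis_derive_cst 1 t.
congr (cis_derive _ _ _); apply/funext => s.
by have [_ [_ <-]] := rhod s.
Qed.

End DensityFamily.

(** * The output family of the channel, and basis-state inputs *)

Lemma id_tens_cq r a b (omega : 'I_a -> R -> 'M[C]_b) t (rho : 'M[C]_(r * a)) :
  id_tens (cq_channel omega t) rho = \sum_x kron (blk x rho) (omega x t).
Proof.
apply/matrixP => p q; rewrite mxE /cq_channel !summxE.
by apply: eq_bigr => x _; rewrite !mxE.
Qed.

Lemma dmx_id_tens_cq r a b (omega : 'I_a -> R -> 'M[C]_b)
    (rho : R -> 'M[C]_(r * a)) t :
  (forall x, mx_derivable (omega x) t) -> mx_derivable rho t ->
  dmx (fun s => id_tens (cq_channel omega s) (rho s)) t =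
  \sum_x (kron (blk x (dmx rho t)) (omega x t) +
          kron (blk x (rho t)) (dmx (omega x) t)).
Proof.
move=> domega drho; apply/matrixP => p q; apply: dmxE; rewrite summxE.
under eq_fun do rewrite id_tens_cq summxE.
apply: cis_derive_sum => x.
have := cis_deriveM (mx_derivable_cis drho (mxvec_index (pair_of_index p).1 x)
    (mxvec_index (pair_of_index q).1 x))
  (mx_derivable_cis (domega x) (pair_of_index p).2 (pair_of_index q).2).
congr (cis_derive _ _ _); last by rewrite !mxE.
by apply/funext => s; rewrite !mxE.
Qed.

Lemma SLD_FI_0 n (rho : 'M[C]_n) : SLD_FI rho 0 = 0%E.
Proof.
rewrite /SLD_FI !(mulmx0, mul0mx) eqxx big1 ?mulr0// => j _.
by rewrite big1// => k _; rewrite mxE normr0 expr0n mul0r.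
Qed.

Lemma SLD_FI_gtNy n (rho D : 'M[C]_n) : (-oo < SLD_FI rho D)%E.
Proof. by rewrite /SLD_FI; case: ifP => _; rewrite ltNye. Qed.

Lemma density_delta n (i : 'I_n) : density (delta_mx i i : 'M[C]_n).
Proof.
have dE : delta_mx i i =
    (delta_mx i 0 : 'cV[C]_n) *m 1%:M *m (delta_mx i 0 : 'cV[C]_n) ^t*.
  by rewrite trmx_delta map_delta_mx mulmx1 mul_delta_mx.
split; first by rewrite dE; exact/hermitian_congr/hermitian1.
split; first by rewrite dE; exact/psd_congr/psd1.
by rewrite /mxtrace (bigD1 i)//= big1 ?addr0 => [|j /negPf ji];
  rewrite mxE ?eqxx// ji.
Qed.

Lemma blk_delta a (x y : 'I_a) :
  blk y (delta_mx (mxvec_index (0 : 'I_1) x) (mxvec_index 0 x)) =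
  (y == x)%:R%:M :> 'M[C]_1.
Proof.
by apply/matrixP => i j; rewrite !ord1 !mxE !eq_mxvec_index eqxx/= andbb mulr1n.
Qed.

End ComplexDerivative.

(** * The two equalities, from a cycle of three inequalities *)

Theorem mainTheorem7 (R : realType) (dX dB : nat)
  (omega : 'I_dX -> R -> 'M[complex R]_dB) (theta : R) :
  (0 < dX)%N ->
  (forall x, diff_density_family (omega x)) ->
  FI_channel (cq_channel omega) theta = FI_amortized (cq_channel omega) theta /\
  FI_amortized (cq_channel omega) theta =
    ereal_sup [set FI_family (omega x) theta | x in [set: 'I_dX]].
Proof.
move=> dX0 omegaf; set S := ereal_sup _.
have omegad x : density (omega x theta) by exact: (omegaf x).1.
have omegaD x : mx_derivable (omega x) theta by exact: (omegaf x).2.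
have Wh x : hermitian (dmx (omega x) theta) by exact: hermitian_dmx.
have Wtr x : \tr (dmx (omega x) theta) = 0 by exact: tr_dmx.
have channel_le : (FI_channel (cq_channel omega) theta <=
                   FI_amortized (cq_channel omega) theta)%E.
  apply: ge_ereal_sup => _ [r [rho [rhod ->]]].
  (* A constant input family has zero information, so nothing is subtracted. *)
  apply: ereal_sup_ubound; exists r, (fun=> rho).
  rewrite [FI_family (fun=> rho) _]/FI_family dmx_cst SLD_FI_0 sube0.
  by split=> //; split=> // t; exact: mx_derivable_cst.
have amortized_le : (FI_amortized (cq_channel omega) theta <= S)%E.
  have Sge x : (FI_family (omega x) theta <= S)%E.
    by apply: ereal_sup_ubound; exists x.
  apply: ge_ereal_sup => _ [r [rho [rhof [FIlt ->]]]].
  (* The value +oo is trivial; -oo is impossible because the alphabet is nonempty and no information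
     value is -oo. *)
  move: Sge; case: S => [c| |] Sge; last 2 first.
  - exact: leey.
  - have := Sge (Ordinal dX0); rewrite leeNy_eq => /eqP FINy.
    by have := SLD_FI_gtNy (omega (Ordinal dX0) theta)
      (dmx (omega (Ordinal dX0)) theta);
      rewrite -/(FI_family _ _) FINy ltxx.
  rewrite leeBlDr; last by rewrite fin_numElt FIlt SLD_FI_gtNy.
  rewrite addeC {1}/FI_family dmx_id_tens_cq//; last exact: rhof.2.
  rewrite id_tens_cq; apply: SLD_FI_cq_le => //; first exact: rhof.1.
  exact: hermitian_dmx.
have sup_le : (S <= FI_channel (cq_channel omega) theta)%E.
  (* With a one-dimensional reference, the input |x><x| has x as its only nonzero block, so the
     output is [omega x] up to reindexing. *)
  apply: ge_ereal_sup => _ [x _ <-]; pose p := mxvec_index (0 : 'I_1) x.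
  apply: le_trans (ereal_sup_ubound _); last first.
    by exists 1, (delta_mx p p); split=> //; exact: density_delta.
  rewrite /FI_family (dmx_id_tens_cq (rho := fun=> delta_mx p p))//.
  have sumE (F : 'I_dX -> 'M[complex R]_dB) :
      \sum_y kron (blk y (delta_mx p p : 'M[complex R]_(1 * dX))) (F y) =
      kron 1%:M (F x).
    rewrite (bigD1 x)//= blk_delta eqxx big1 ?addr0// => y /negPf yx.
    by rewrite blk_delta yx; apply/matrixP => i j; rewrite !mxE mul0rn mul0r.
  rewrite id_tens_cq dmx_cst big_split/= !sumE big1 ?add0r; last first.
    by move=> y _; apply/matrixP => i j; rewrite !mxE mul0r.
  by apply: SLD_FI_kron1_ge => //; exact: mxtrace1.
by split; apply/eqP; rewrite eq_le; apply/andP; split=> //;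
  [exact: le_trans sup_le|exact: le_trans channel_le].
Qed.
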